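(* Let $n$ and $k$ be positive integers. There is a one-to-one correspondence between the generalized permutations $$\begin{pmatrix} a_1 & a_2 & \cdots & a_n\\ b_1 & b_2 & \cdots & b_n\end{pmatrix}$$ in which $a_1,\ldots,a_n$ are (possibly empty) multisets over $[k]$ and $b_1,\ldots,b_n$ are distinct elements of $[n]$, and the pairs $(S,T)$ such that: $S$ and $T$ are tableaux of the same shape; $S$ is a standard Young tableau of size $n$; and $T$ is a semistandard multiset tableau with entries multisets over $[k]$. Under this correspondence, the content of $T$ is $a_1\uplus\cdots\uplus a_n$.
   Context: $[k]=\{1,\ldots,k\}$ with its usual order. A multiset over $[k]$ is a finite unordered collection of elements of $[k]$ with repetition allowed (the empty multiset is allowed); $\uplus$ denotes union of multisets with multiplicities added. Graded lexicographic order on multisets over $[k]$: if $M=\{\!\{a_1\le\cdots\le a_r\}\!\}$ and $M'=\{\!\{a'_1\le\cdots\le a'_t\}\!\}$, then $M<M'$ if $r<t$, or if $r=t$ and there is $i$ with $a_1=a'_1,\ldots,a_{i-1}=a'_{i-1}$ and $a_i<a'_i$. This is a total order with minimum the empty multiset. Multisets are compared in this order below. A generalized permutation with top row $a_1,\ldots,a_n$ in an ordered set and bottom row $b_1,\ldots,b_n$ in an ordered set is a two-line array satisfying $a_i\le a_{i+1}$ for $1\le i\le n-1$, and $b_i\le b_{i+1}$ whenever $a_i=a_{i+1}$. The diagram of a partition $\lambda=(\lambda_1\ge\cdots\ge\lambda_r>0)$ has $\lambda_j$ left-justified cells in row $j$. A semistandard multiset tableau of shape $\lambda$ is a filling of the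 cells of $\lambda$ by multisets over $[k]$ (empty multiset allowed) such that entries weakly increase along each row from left to right, and strictly increase in each column when passing from row $j$ to row $j+1$. Its content is the multiset union $\uplus$ of all its entries. A standard Young tableau of size $n$ is a filling of the diagram of a partition of $n$ by $1,\ldots,n$, each used exactly once, strictly increasing along rows (left to right) and along columns (from row $j$ to row $j+1$). *)

(* Defs.v *)
From mathcomp Require Import all_boot all_order.
From mathcomp Require Import finmap multiset.

Set Implicit Arguments.
Unset Strict Implicit.
Unset Printing Implicit Defensive.

Local Open Scope nat_scope.
Local Open Scope mset_scope.

(* The ordered set [m] = {1, ..., m} is represented by 'I_m = {0, ..., m - 1}
   with its natural order; multisets over [k] are {mset 'I_k}. *)

(* The elements of M listed in weakly increasing order, with multiplicity. *)
Definition mset_word (k : nat) (M : {mset 'I_k}) : seq 'I_k :=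
  sort <=%O (enum_mset M).

(* Graded lexicographic order. *)
Definition mset_lt (k : nat) : rel {mset 'I_k} := fun M M' =>
  (size (mset_word M) < size (mset_word M')) ||
  ((size (mset_word M) == size (mset_word M')) &&
   ((mset_word M : seqlexi 'I_k) < (mset_word M' : seqlexi 'I_k))%O).

Definition mset_le (k : nat) : rel {mset 'I_k} := fun M M' =>
  (M == M') || mset_lt M M'.

Definition mset_union (k : nat) (s : seq {mset 'I_k}) : {mset 'I_k} :=
  \big[msetD/mset0]_(M <- s) M.

Definition is_generalized_permutation (A B : eqType) (leA : rel A) (leB : rel B)
    (n : nat) (a : n.-tuple A) (b : n.-tuple B) : bool :=
  sorted (fun p q : A * B =>
    leA p.1 q.1 && ((p.1 == q.1) ==> leB p.2 q.2)) (zip a b).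

Definition is_partition (la : seq nat) : bool :=
  sorted geq la && (0 \notin la).

(* A filling is given as the list of its rows. In the column condition, zip
   truncates the longer row, so row j is compared with row j + 1 exactly at the
   columns having a cell in both. *)
Definition is_tableau (A : Type) (row_rel col_rel : rel A)
    (t : seq (seq A)) : bool :=
  [&& is_partition (shape t),
      all (sorted row_rel) t &
      sorted (fun r r' : seq A => all (fun p => col_rel p.1 p.2) (zip r r')) t].

Definition is_semistandard_multiset_tableau (k : nat)
    (t : seq (seq {mset 'I_k})) : bool :=
  is_tableau (@mset_le k) (@mset_lt k) t.

Definition is_standard_Young_tableau (n : nat) (t : seq (seq 'I_n)) : bool :=
  is_tableau <%O <%O t && perm_eq (flatten t) (enum 'I_n).

Definition content (k : nat) (t : seq (seq {mset 'I_k})) : {mset 'I_k} :=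
  mset_union (flatten t).

Definition multiset_gen_perm (n k : nat) : Type :=
  {w : n.-tuple {mset 'I_k} * n.-tuple 'I_n |
     is_generalized_permutation (@mset_le k) <=%O w.1 w.2 && uniq w.2}.

Definition tableau_pair (n k : nat) : Type :=
  {ST : seq (seq 'I_n) * seq (seq {mset 'I_k}) |
     [&& shape ST.1 == shape ST.2,
         is_standard_Young_tableau ST.1 &
         is_semistandard_multiset_tableau ST.2]}.

(* Main.v *)
Require Import Defs.
From HB Require Import structures.
From mathcomp Require Import all_boot all_order.
From mathcomp Require Import finmap multiset.

Set Implicit Arguments.
Unset Strict Implicit.
Unset Printing Implicit Defensive.

Import Order.TTheory.
Local Open Scope nat_scope.

(** Since b_1, ..., b_n are the n distinct elements of [n], a generalized
permutation is the same thing as an arbitrary word u_1 ... u_n of multisets: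
u_j is the a_i with b_i = j, and conversely the array is recovered by sorting
its columns lexicographically. The statement therefore reduces to the
Robinson-Schensted correspondence for words over a totally ordered alphabet,
where T is the insertion tableau of the word and S its recording tableau. In
this form every new label of S exceeds all the earlier ones, so that the cell
added last can always be told from S.

The two tableaux are handled as one bitableau, a filling by pairs (label,
entry). Inserting x with label m leaves the existing labels in place: in each
row x replaces the leftmost entry exceeding it, which is then inserted in the
next row, until the entry to be inserted is exceeded by none in its row and is
appended there with label m. The step is invertible because the cell with the
largest label m must end the row where the insertion stopped; going back up, a
displaced y came from the rightmost place where the entry is now smaller than
y. Insertion preserves bitableaux ([insert_is_bitableau]), undoing it gives back its
arguments ([insertK]), and every bitableau with largest label m arises
([uninsertK]). By induction on the word, the map from words to bitableaux is
injective ([RS_inj]) and surjective ([RS_surj]). Insertion only moves entries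
around ([RS_entries]), whence the claim on contents.

The alphabet of multisets is totally ordered by the graded lexicographic order
because a multiset is determined by the sorted list of its elements. *)

(** * Finding and replacing in sequences *)

Lemma find_eq (T : Type) (a : pred T) (z : T) (s : seq T) (j : nat) :
    j <= size s -> (forall i, i < j -> ~~ a (nth z s i)) ->
    (j < size s -> a (nth z s j)) ->
  find a s = j.
Proof.
move=> le_js before at_j; case: (ltngtP (find a s) j) => // [lt_fj | lt_jf].
  have := before _ lt_fj; rewrite nth_find // has_find.
  exact: leq_trans lt_fj le_js.
have := before_find z lt_jf; rewrite at_j //.
exact: leq_trans lt_jf (find_size a s).
Qed.

Lemma perm_set_nth (T : eqType) (z y : T) (s : seq T) i : i < size s ->
  perm_eq (nth z s i :: set_nth z s i y) (y :: s).
Proof.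
move=> lt_i; rewrite set_nthE lt_i -[in X in perm_eq _ X](cat_take_drop i s).
rewrite (drop_nth z lt_i); apply/permP => a; rewrite /= !count_cat /=.
by rewrite addnCA [RHS]addnCA (addnCA (a y)).
Qed.

Lemma map_set_nth (T U : Type) (h : T -> U) z (s : seq T) i y : i < size s ->
  map h (set_nth z s i y) = set_nth (h z) (map h s) i (h y).
Proof.
by move=> lt_i; rewrite !set_nthE size_map lt_i map_cat /= map_take map_drop.
Qed.

(** * Bitableaux and insertion *)

Section Bitableaux.

Variables (dL dA : Order.disp_t) (L : orderType dL) (A : orderType dA) (x0 : A).
Implicit Types (m : L) (x y : A) (p : L * A) (r q : seq (L * A)).
Implicit Types t u : seq (seq (L * A)).

Definition row_rel (p p' : L * A) := (p.1 < p'.1)%O && (p.2 <= p'.2)%O.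
Definition col_rel (p p' : L * A) := (p.1 < p'.1)%O && (p.2 < p'.2)%O.

Lemma row_rel_trans : transitive row_rel.
Proof.
move=> q p s /andP[pq1 pq2] /andP[qs1 qs2]; apply/andP; split.
  exact: lt_trans qs1.
exact: le_trans qs2.
Qed.

(** The truncation in [zip] compares only the columns that both rows reach, so
that the rows being those of a partition has to be required separately. *)
Definition above r r' :=
  (size r' <= size r) && all (fun pq => col_rel pq.1 pq.2) (zip r r').

Lemma aboveP z r r' :
  reflect (size r' <= size r /\
           forall i, i < size r' -> col_rel (nth z r i) (nth z r' i))
          (above r r').
Proof.
apply: (iffP andP) => [] [szr H]; split=> //.
  move=> i lt_i; move/(all_nthP (z, z)): H => /(_ i).
  rewrite size_zip (minn_idPr szr) nth_zip_cond size_zip (minn_idPr szr) lt_i.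
  exact.
apply/(all_nthP (z, z)) => i; rewrite nth_zip_cond => lt_i; rewrite lt_i /=.
by apply: H; move: lt_i; rewrite size_zip (minn_idPr szr).
Qed.

(** Taking the row below to be empty when there is none makes the condition on
a row the same everywhere, since every row is above the empty one. *)
Fixpoint is_bitableau t : bool :=
  if t is r :: t' then
    [&& 0 < size r, sorted row_rel r, above r (head [::] t') & is_bitableau t']
  else true.

Definition labels t := map fst (flatten t).
Definition entries t := map snd (flatten t).

Definition bump_pos x r := find (fun p => (x < p.2)%O) r.

(** When no entry exceeds x the position is the size of the row, and there
[set_nth] extends the row by a cell whose label is that of the default, m.
Appending and replacing are thus a single formula. *)
Definition row_insert m x r :=
  let i := bump_pos x r in
  set_nth (m, x0) r i ((nth (m, x0) r i).1, x).

Fixpoint insert m x t :=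
  if t is r :: t' then
    row_insert m x r ::
      (if bump_pos x r < size r
       then insert m (nth (m, x0) r (bump_pos x r)).2 t' else t')
  else [:: row_insert m x [::]].

(** The rightmost place with an entry below y; the predecessor is taken because
[find] stops at the first entry that is at least y. *)
Definition unbump_pos y r := (find (fun p => (y <= p.2)%O) r).-1.

Definition row_uninsert m y r :=
  let j := unbump_pos y r in
  set_nth (m, x0) r j ((nth (m, x0) r j).1, y).

(** The label m marks the row where the insertion stopped. The rows above it
are undone from the bottom up, each receiving what the one below gives back. *)
Fixpoint uninsert m t : A * seq (seq (L * A)) :=
  if t is r :: t' then
    if (last (m, x0) r).1 == m then
      let r0 := take (size r).-1 r in
      ((last (m, x0) r).2, if size r0 == 0 then t' else r0 :: t')
    else
      let: (y, u) := uninsert m t' in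
      ((nth (m, x0) r (unbump_pos y r)).2, row_uninsert m y r :: u)
  else (x0, [::]).

Lemma bump_pos_size x r : bump_pos x r <= size r.
Proof. exact: find_size. Qed.

Lemma size_row_insert m x r :
  size (row_insert m x r) = maxn (bump_pos x r).+1 (size r).
Proof. by rewrite size_set_nth. Qed.

Lemma nth_row_insert m x r i :
  nth (m, x0) (row_insert m x r) i =
  if i == bump_pos x r then ((nth (m, x0) r i).1, x) else nth (m, x0) r i.
Proof. by rewrite nth_set_nth /=; case: eqP => // ->. Qed.

Lemma nth_lt_bump z x r i : i < bump_pos x r -> ((nth z r i).2 <= x)%O.
Proof. by move=> /(before_find z) /negbT; rewrite -leNgt. Qed.

Lemma row_sortedP z r i j : sorted row_rel r -> i < j < size r ->
  row_rel (nth z r i) (nth z r j).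
Proof.
move=> r_srt /andP[lt_ij lt_j].
apply: (sorted_ltn_nth row_rel_trans) => //; rewrite inE //.
exact: ltn_trans lt_j.
Qed.

Lemma row_sorted_le z r i j : sorted row_rel r -> i <= j -> j < size r ->
  ((nth z r i).2 <= (nth z r j).2)%O.
Proof.
move=> r_srt; rewrite leq_eqVlt => /predU1P[-> // | lt_ij] lt_j.
by have /andP[] : row_rel (nth z r i) (nth z r j) by rewrite row_sortedP ?lt_ij.
Qed.

Lemma nth_ge_bump z x r i : sorted row_rel r -> bump_pos x r <= i ->
  i < size r -> (x < (nth z r i).2)%O.
Proof.
move=> r_srt le_i lt_i; apply: lt_le_trans (row_sorted_le z r_srt le_i lt_i).
apply: (@nth_find _ z (fun p => (x < p.2)%O)); rewrite has_find.
exact: leq_ltn_trans lt_i.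
Qed.

Lemma row_insert_append m x r : bump_pos x r = size r ->
  row_insert m x r = rcons r (m, x).
Proof.
by move=> e; rewrite /row_insert e set_nthE ltnn subnn /= nth_default // cats1.
Qed.

Lemma row_insert_bump m x r : bump_pos x r < size r ->
  size (row_insert m x r) = size r.
Proof. by rewrite size_row_insert => /maxn_idPr. Qed.

Lemma map_set_nth_label z r i x : i < size r ->
  map fst (set_nth z r i ((nth z r i).1, x)) = map fst r.
Proof.
move=> lt_i; apply: (@eq_from_nth _ z.1).
  by rewrite !size_map size_set_nth; apply/maxn_idPr.
move=> j; rewrite size_map size_set_nth (maxn_idPr lt_i) => lt_j.
rewrite !(nth_map z) ?size_set_nth ?(maxn_idPr lt_i) //.
by rewrite nth_set_nth /=; case: eqP => // ->.
Qed.

Lemma row_insert_sorted m x r : sorted row_rel r ->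
    all (fun l => l < m)%O (map fst r) ->
  sorted row_rel (row_insert m x r).
Proof.
move=> r_srt r_m; apply/(sortedP (m, x0)) => i; rewrite !nth_row_insert.
rewrite size_row_insert => lt_i.
case: (ltngtP i.+1 (size r)) => [lt_ir | lt_ri | eq_ir].
- have /andP[lt_l le_x] : row_rel (nth (m, x0) r i) (nth (m, x0) r i.+1).
    by apply: row_sortedP => //; rewrite ltnSn.
  apply/andP; split; first by do 2?case: eqP.
  case: eqP => [ei | nei]; case: eqP => [ei1 | nei1] //=.
    by apply/ltW/nth_ge_bump => //; rewrite -ei.
  by apply: nth_lt_bump; rewrite -ei1.
- move: lt_i; rewrite leq_max [i.+1 < size r]ltnNge (ltnW lt_ri) orbF.
  rewrite ltnS => lt_i.
  by have := leq_trans lt_i (bump_pos_size x r); rewrite leqNgt lt_ri.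
- move: lt_i; rewrite leq_max -eq_ir ltnn orbF ltnS => lt_i.
  have -> : i.+1 == bump_pos x r.
    by rewrite eqn_leq lt_i eq_ir bump_pos_size.
  rewrite ltn_eqF // [nth _ r i.+1]nth_default ?eq_ir //.
  apply/andP; split=> /=; last exact: nth_lt_bump.
  move/(all_nthP m): r_m => /(_ i).
  rewrite size_map -eq_ir (nth_map (m, x0)) ?eq_ir //.
  by apply; rewrite -eq_ir.
Qed.

(** The bumping path moves weakly to the left: either the next row has a cell
under the bumped y, whose entry exceeds y by column strictness, or it ends
before that column. *)
Lemma bump_pos_above m x r r' :
    sorted row_rel r -> above r r' -> bump_pos x r < size r ->
  bump_pos (nth (m, x0) r (bump_pos x r)).2 r' <= bump_pos x r.
Proof.
move=> r_srt /(aboveP (m, x0))[_ rr'] lt_i; rewrite leqNgt; apply/negP => lt_ii'.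
have lt_i' := leq_trans lt_ii' (bump_pos_size _ r').
have /andP[_] := rr' _ lt_i'.
by rewrite ltNge (nth_lt_bump _ lt_ii').
Qed.

(** Only the two replaced cells matter. Above, x is smaller than the y it
replaces. Below, y lands weakly left of that cell, hence under either x or an
entry at most x, and x < y. *)
Lemma row_insert_above m x r r' (i := bump_pos x r) :
    sorted row_rel r -> above r r' -> i < size r ->
    all (fun l => l < m)%O (map fst r) ->
  above (row_insert m x r) (row_insert m (nth (m, x0) r i).2 r').
Proof.
move=> r_srt rr' lt_i r_m; have le_i'i := bump_pos_above m r_srt rr' lt_i.
case/(aboveP (m, x0)): rr' => le_sz rr'; apply/(aboveP (m, x0)).
rewrite (row_insert_bump m lt_i) size_row_insert.
split=> [|j]; first by rewrite geq_max le_sz (leq_ltn_trans le_i'i).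
rewrite !nth_row_insert -/i in le_i'i * => lt_j.
set i' := bump_pos _ r' in le_i'i lt_j *.
have [eji' | neji'] := eqVneq j i'; last first.
  have lt_jr' : j < size r'.
    move: lt_j; rewrite leq_max ltnS => /orP[le_ji' | //].
    by apply: (@leq_trans i'); [rewrite ltn_neqAle neji' | exact: bump_pos_size].
  have /andP[lt_l lt_x] := rr' _ lt_jr'.
  have [eji | _] := eqVneq j i; last exact/andP.
  apply/andP; split=> //=; apply: lt_trans lt_x.
  by apply: nth_ge_bump => //; rewrite eji.
apply/andP; split.
  suff lt_l : ((nth (m, x0) r j).1 < (nth (m, x0) r' j).1)%O by case: ifP.
  have [lt_jr' | le_r'j] := ltnP j (size r'); first by case/andP: (rr' _ lt_jr').
  rewrite [nth _ r' j]nth_default //=.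
  move/(all_nthP m): r_m => /(_ j); rewrite size_map (nth_map (m, x0)).
    by apply; rewrite eji' (leq_ltn_trans le_i'i).
  by rewrite eji' (leq_ltn_trans le_i'i).
have x_lt : (x < (nth (m, x0) r i).2)%O by apply: nth_ge_bump.
case: eqP => [// | /eqP neji] /=.
apply: le_lt_trans x_lt; apply: nth_lt_bump.
by rewrite ltn_neqAle neji eji'.
Qed.

Lemma head_insert m x t :
  head [::] (insert m x t) = row_insert m x (head [::] t).
Proof. by case: t. Qed.

Lemma labels_cons r t : labels (r :: t) = map fst r ++ labels t.
Proof. by rewrite /labels /= map_cat. Qed.

Lemma entries_cons r t : entries (r :: t) = map snd r ++ entries t.
Proof. by rewrite /entries /= map_cat. Qed.

Lemma insert_is_bitableau m x t : is_bitableau t ->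
  all (fun l => l < m)%O (labels t) -> is_bitableau (insert m x t).
Proof.
elim: t x => [//|r t IHt] x /= /and4P[r_gt0 r_srt rt t_ok].
rewrite labels_cons all_cat => /andP[r_m t_m].
apply/and4P; split.
- by rewrite size_row_insert leq_max.
- exact: row_insert_sorted.
- case: ifP => [lt_i | /negbT]; first by rewrite head_insert row_insert_above.
  rewrite -leqNgt => le_ri.
  rewrite row_insert_append; last by apply/eqP; rewrite eqn_leq bump_pos_size.
  case/(aboveP (m, x0)): rt => le_sz rt; apply/(aboveP (m, x0)).
  rewrite size_rcons; split=> [|j lt_j]; first exact: leqW.
  by rewrite nth_rcons (leq_trans lt_j le_sz) rt.
- by case: ifP => // _; apply: IHt.
Qed.

Lemma insert_labels m x t : perm_eq (labels (insert m x t)) (m :: labels t).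
Proof.
elim: t x => [//|r t IHt] x /=; rewrite !labels_cons; case: ifP => lt_i.
  rewrite map_set_nth_label // -[m :: _]cat1s perm_sym perm_catCA.
  by rewrite perm_cat2l perm_sym.
move: lt_i => /negbT; rewrite -leqNgt => le_ri.
rewrite row_insert_append ?map_rcons -?cats1 -?catA /=; last first.
  by apply/eqP; rewrite eqn_leq bump_pos_size.
by rewrite -cat1s perm_catCA.
Qed.

Lemma insert_entries m x t : perm_eq (entries (insert m x t)) (x :: entries t).
Proof.
elim: t x => [//|r t IHt] x /=; rewrite !entries_cons; case: ifP => lt_i.
  rewrite map_set_nth //.
  apply: (perm_trans (perm_cat (perm_refl _) (IHt _))).
  rewrite -[_ :: entries t]cat1s perm_catCA /= -cat_cons -[x :: _]cat_cons.
  rewrite perm_cat2r.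
  rewrite -(nth_map (m, x0) x0 snd) //.
  by apply: perm_set_nth; rewrite size_map.
move: lt_i => /negbT; rewrite -leqNgt => le_ri.
rewrite row_insert_append ?map_rcons -?cats1 -?catA /=; last first.
  by apply/eqP; rewrite eqn_leq bump_pos_size.
by rewrite -cat1s perm_catCA.
Qed.

Lemma last_label_row m r : 0 < size r -> (last (m, x0) r).1 \in map fst r.
Proof. by case: r => // p r _; exact: (map_f fst (mem_last p r)). Qed.

Lemma unbump_row_insert m x r (y := (nth (m, x0) r (bump_pos x r)).2) :
    sorted row_rel r -> bump_pos x r < size r ->
  unbump_pos y (row_insert m x r) = bump_pos x r.
Proof.
move=> r_srt lt_i; rewrite /unbump_pos.
rewrite (@find_eq _ _ (m, x0) _ (bump_pos x r).+1) ?row_insert_bump //.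
  move=> j; rewrite ltnS leq_eqVlt nth_row_insert -ltNge.
  have x_lt : (x < y)%O by apply: nth_ge_bump.
  case: eqP => [-> //|_] /= lt_j.
  by apply: le_lt_trans x_lt; apply: nth_lt_bump.
move=> lt_i1; rewrite nth_row_insert gtn_eqF //.
exact: row_sorted_le.
Qed.

Lemma row_insertK m x r (y := (nth (m, x0) r (bump_pos x r)).2) :
    sorted row_rel r -> bump_pos x r < size r ->
  row_uninsert m y (row_insert m x r) = r.
Proof.
move=> r_srt lt_i; rewrite /row_uninsert unbump_row_insert //.
rewrite nth_row_insert eqxx /= /row_insert set_set_nth eqxx -surjective_pairing.
apply: (@eq_from_nth _ (m, x0)); rewrite size_set_nth (maxn_idPr lt_i) //.
by move=> j _; rewrite nth_set_nth /=; case: eqP => [->|].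
Qed.

(** Labels below m let [uninsert] recognize the row that received m. *)
Lemma insertK m x t : is_bitableau t -> all (fun l => l < m)%O (labels t) ->
  uninsert m (insert m x t) = (x, t).
Proof.
elim: t x => [|r t IHt] x /=; first by rewrite eqxx.
case/and4P=> r_gt0 r_srt rt t_ok; rewrite labels_cons all_cat => /andP[r_m t_m].
case: (ltnP (bump_pos x r) (size r)) => [lt_i | le_ri].
  have /(allP r_m)/lt_eqF-> : (last (m, x0) (row_insert m x r)).1 \in map fst r.
    rewrite -(map_set_nth_label (m, x0) x lt_i).
    by rewrite last_label_row // row_insert_bump.
  by rewrite IHt // unbump_row_insert // row_insertK // nth_row_insert eqxx.
rewrite row_insert_append; last by apply/eqP; rewrite eqn_leq bump_pos_size.
rewrite last_rcons eqxx size_rcons /= -cats1 take_size_cat //.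
by rewrite size_eq0 -size_eq0 -leqn0 leqNgt r_gt0.
Qed.

(** The existence of an entry below y ensures that the predecessor in
[unbump_pos] is not taken of 0. *)
Lemma unbump_posP m y r : sorted row_rel r ->
    (exists2 i, i < size r & ((nth (m, x0) r i).2 < y)%O) ->
  [/\ unbump_pos y r < size r,
      forall i, i <= unbump_pos y r -> ((nth (m, x0) r i).2 < y)%O &
      forall i, unbump_pos y r < i < size r -> (y <= (nth (m, x0) r i).2)%O].
Proof.
move=> r_srt [i0 lt_i0 lt_y].
have ge_find i : find (fun p => (y <= p.2)%O) r <= i -> i < size r ->
    (y <= (nth (m, x0) r i).2)%O.
  move=> le_i lt_i; apply: le_trans (row_sorted_le _ r_srt le_i lt_i).
  apply: (@nth_find _ (m, x0) (fun p => (y <= p.2)%O)); rewrite has_find.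
  exact: leq_ltn_trans lt_i.
have find_gt0 : 0 < find (fun p => (y <= p.2)%O) r.
  rewrite lt0n; apply/eqP => find0.
  by have := ge_find i0; rewrite find0 leNgt lt_y => /(_ isT lt_i0).
have e : (unbump_pos y r).+1 = find (fun p => (y <= p.2)%O) r by rewrite prednK.
split=> [|i le_i|i /andP[lt_i]]; first by rewrite e find_size.
  rewrite ltNge; apply/negbT.
  by apply: (@before_find _ (m, x0) (fun p => (y <= p.2)%O)); rewrite -e ltnS.
by apply: ge_find; rewrite -e.
Qed.

Lemma nth_row_uninsert m y r i :
  nth (m, x0) (row_uninsert m y r) i =
  if i == unbump_pos y r then ((nth (m, x0) r i).1, y) else nth (m, x0) r i.
Proof. by rewrite nth_set_nth /=; case: eqP => // ->. Qed.

Lemma size_row_uninsert m y r : unbump_pos y r < size r ->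
  size (row_uninsert m y r) = size r.
Proof. by rewrite size_set_nth => /maxn_idPr. Qed.

Lemma row_uninsert_sorted m y r : sorted row_rel r ->
    (exists2 i, i < size r & ((nth (m, x0) r i).2 < y)%O) ->
  sorted row_rel (row_uninsert m y r).
Proof.
move=> r_srt r_y.
have [lt_j le_y ge_y] := unbump_posP r_srt r_y.
apply/(sortedP (m, x0)) => i; rewrite size_row_uninsert // !nth_row_uninsert.
move=> lt_i.
have /andP[lt_l le_x] : row_rel (nth (m, x0) r i) (nth (m, x0) r i.+1).
  by apply: row_sortedP => //; rewrite ltnSn.
apply/andP; split; first by do 2?case: eqP.
case: eqP => [ei | nei]; case: eqP => [ei1 | nei1] //=.
  by apply: ge_y; rewrite -ei ltnSn.
by apply/ltW/le_y; rewrite -ei1.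
Qed.

Lemma bump_row_uninsert m y r (x := (nth (m, x0) r (unbump_pos y r)).2) :
    sorted row_rel r ->
    (exists2 i, i < size r & ((nth (m, x0) r i).2 < y)%O) ->
  bump_pos x (row_uninsert m y r) = unbump_pos y r.
Proof.
move=> r_srt r_y.
have [lt_j le_y ge_y] := unbump_posP r_srt r_y.
apply: (find_eq (z := (m, x0))); rewrite ?size_row_uninsert //; first exact: ltnW.
  move=> i lt_i; rewrite nth_row_uninsert ltn_eqF // -leNgt.
  by apply: row_sorted_le => //; apply: ltnW.
by move=> _; rewrite nth_row_uninsert eqxx /=; apply: le_y.
Qed.

Lemma row_uninsertK m y r (x := (nth (m, x0) r (unbump_pos y r)).2) :
    sorted row_rel r ->
    (exists2 i, i < size r & ((nth (m, x0) r i).2 < y)%O) ->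
  row_insert m x (row_uninsert m y r) = r.
Proof.
move=> r_srt r_y.
have [lt_j _ _] := unbump_posP r_srt r_y.
rewrite /row_insert bump_row_uninsert // nth_row_uninsert eqxx /= set_set_nth eqxx.
rewrite -surjective_pairing.
apply: (@eq_from_nth _ (m, x0)); rewrite size_set_nth (maxn_idPr lt_j) //.
by move=> j _; rewrite nth_set_nth /=; case: eqP => [->|].
Qed.

(** A cell of r lies over the one into which y was inserted, and its entry is
smaller than y by column strictness. This is what allows y to be sent back. *)
Lemma above_row_insert_exists m y r q : above r (row_insert m y q) ->
  exists2 i, i < size r & ((nth (m, x0) r i).2 < y)%O.
Proof.
case/(aboveP (m, x0)) => le_sz rq; exists (bump_pos y q).
  by apply: leq_trans le_sz; rewrite size_row_insert leq_max ltnSn.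
have := rq (bump_pos y q); rewrite size_row_insert leq_max ltnSn => /(_ isT).
by case/andP=> _; rewrite nth_row_insert eqxx.
Qed.

(** The place to which y returns is weakly right of the cell that it leaves, and
from that cell on the entries of q exceed y. *)
Lemma row_uninsert_above m y r q : sorted row_rel r -> sorted row_rel q ->
  above r (row_insert m y q) -> above (row_uninsert m y r) q.
Proof.
move=> r_srt q_srt rq; have r_y := above_row_insert_exists rq.
have [lt_j le_y ge_y] := unbump_posP r_srt r_y.
case/(aboveP (m, x0)): rq; rewrite size_row_insert => le_sz rq.
have le_j' : bump_pos y q <= unbump_pos y r.
  rewrite leqNgt; apply/negP => lt_j'.
  have lt_szq : bump_pos y q < maxn (bump_pos y q).+1 (size q).
    by rewrite leq_max ltnSn.
  have := rq _ lt_szq; rewrite nth_row_insert eqxx => /andP[_ /=].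
  by rewrite ltNge ge_y // lt_j' (leq_trans lt_szq).
apply/(aboveP (m, x0)); rewrite size_row_uninsert //; split=> [|i lt_i].
  by apply: leq_trans le_sz; rewrite leq_maxr.
have := rq i; rewrite leq_max lt_i orbT => /(_ isT).
rewrite nth_row_uninsert nth_row_insert => /andP[lt_l lt_x].
have lt_l' : ((nth (m, x0) r i).1 < (nth (m, x0) q i).1)%O.
  by move: lt_l; case: ifP.
apply/andP; split; first by case: ifP.
have [eij | _] := eqVneq i (unbump_pos y r).
  by apply: nth_ge_bump => //; rewrite eij.
move: lt_x; case: eqP => // eij' /= lt_y; apply: lt_trans lt_y _.
by apply: nth_ge_bump => //; rewrite eij'.
Qed.

Lemma bitableau_head_sorted t : is_bitableau t -> sorted row_rel (head [::] t).
Proof. by case: t => //= r t /and4P[]. Qed.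

Lemma mem_head_labels p t : p \in head [::] t -> p.1 \in labels t.
Proof. by case: t => //= r t rp; rewrite labels_cons mem_cat map_f. Qed.

(** The cell of the largest label m ends its row and has no cell below it, as
either neighbour would carry a larger label; removing it leaves a bitableau.
In the rows above, m does not occur, and the induction hypothesis presents the
rows below as the result of an insertion, from which the next row is undone. *)
Lemma uninsertK m t : is_bitableau t -> all (fun l => l <= m)%O (labels t) ->
    m \in labels t ->
  is_bitableau (uninsert m t).2 /\
  insert m (uninsert m t).1 (uninsert m t).2 = t.
Proof.
elim: t => [//|r t IHt] /=.
case/and4P=> r_gt0 r_srt rt t_ok; rewrite labels_cons all_cat mem_cat.
case/andP=> r_m t_m m_rt; case: eqP => [|/eqP] last_m.
  case/lastP: r r_gt0 r_srt rt r_m m_rt last_m => // r [m' x] _ r_srt rt _ _.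
  rewrite last_rcons size_rcons /= => em; rewrite {m'}em in r_srt rt *.
  have -> : take (size r) (rcons r (m, x)) = r by rewrite -cats1 take_size_cat.
  case/(aboveP (m, x0)): rt; rewrite size_rcons => le_sz rt.
  (* A cell under that of m would carry a label larger than m. *)
  have {le_sz} le_sz : size (head [::] t) <= size r.
    rewrite leqNgt; apply/negP => lt_sz; have /andP[] := rt _ lt_sz.
    rewrite nth_rcons ltnn eqxx /= ltNge => /negP[].
    by apply: (allP t_m); rewrite mem_head_labels ?mem_nth.
  case: posnP => r_gt0.
    move/size0nil: r_gt0 le_sz => -> /=.
    by case: t t_ok {IHt t_m rt} => [|r' t] //= /andP[/leq_trans r'_gt0 _ /r'_gt0].
  (* x ended the row, so it exceeds or equals all that remains there. *)
  have r_x : bump_pos x r = size r.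
    apply: (find_eq (z := (m, x0))); rewrite ?ltnn // => i lt_i; rewrite -leNgt.
    have /andP[_] : row_rel (nth (m, x0) (rcons r (m, x)) i)
                            (nth (m, x0) (rcons r (m, x)) (size r)).
      by apply: row_sortedP => //; rewrite lt_i size_rcons /=.
    by rewrite !nth_rcons lt_i ltnn eqxx.
  rewrite /= r_x ltnn row_insert_append //; split=> //.
  apply/and4P; split=> //.
    by move: r_srt; rewrite -cats1 => /cat_sorted2[].
  apply/(aboveP (m, x0)); split=> // i lt_i.
  by have := rt i lt_i; rewrite nth_rcons (leq_trans lt_i).
(* Labels increase along r, so m could only occur in it at the end. *)
have {m_rt} m_t : m \in labels t.
  case/orP: m_rt => // /mapP[p r_p em]; case/negP: last_m.
  have lt_i := r_p; rewrite -index_mem in lt_i.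
  have ep := nth_index (m, x0) r_p.
  case: (ltngtP (index p r).+1 (size r)) => [lt_i1 | | eq_i].
  - have : row_rel (nth (m, x0) r (index p r)) (nth (m, x0) r (size r).-1).
      apply: row_sortedP => //; rewrite prednK // leqnn andbT.
      by rewrite -ltnS prednK.
    rewrite ep nth_last => /andP[]; rewrite -em ltNge => /negP[].
    exact: (allP r_m _ (last_label_row m r_gt0)).
  - by rewrite ltnNge lt_i.
  - by rewrite -nth_last -eq_i /= ep -em.
case: (uninsert m t) (IHt t_ok t_m m_t) => y u /= [u_ok def_t].
rewrite -def_t head_insert in rt.
have r_y := above_row_insert_exists rt.
have [lt_j _ _] := unbump_posP r_srt r_y.
rewrite bump_row_uninsert // size_row_uninsert // lt_j row_uninsertK //.
rewrite nth_row_uninsert eqxx /= def_t r_gt0 u_ok row_uninsert_sorted //.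
by rewrite row_uninsert_above ?bitableau_head_sorted.
Qed.

(** * The correspondence for words *)

(** The word is listed with its last letter first, so that labels decrease and
the recursion peels off the letter inserted last. *)
Definition RS (w : seq (L * A)) : seq (seq (L * A)) :=
  foldr (fun p t => insert p.1 p.2 t) [::] w.

Lemma RS_labels w : perm_eq (labels (RS w)) (map fst w).
Proof.
elim: w => //= p w IHw; apply: perm_trans (insert_labels _ _ _) _.
by rewrite perm_cons.
Qed.

Lemma RS_entries w : perm_eq (entries (RS w)) (map snd w).
Proof.
elim: w => //= p w IHw; apply: perm_trans (insert_entries _ _ _) _.
by rewrite perm_cons.
Qed.

Lemma RS_labels_lt m w : path >%O m (map fst w) ->
  all (fun l => l < m)%O (labels (RS w)).
Proof.
move=> w_m; rewrite (perm_all _ (RS_labels w)); apply: order_path_min w_m.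
by move=> a b c ba ac; apply: lt_trans ba.
Qed.

Lemma RS_is_bitableau w : sorted >%O (map fst w) -> is_bitableau (RS w).
Proof.
elim: w => //= p w IHw w_p; apply: insert_is_bitableau; last exact: RS_labels_lt.
exact/IHw/path_sorted/w_p.
Qed.

Lemma RS_inj w w' : sorted >%O (map fst w) -> map fst w = map fst w' ->
  RS w = RS w' -> w = w'.
Proof.
elim: w w' => [|[m x] w IHw] [|[m' x'] w'] //= w_m [em ew]; rewrite -{m'}em.
move=> eqRS.
have w'_m : path >%O m (map fst w') by rewrite -ew.
have : uninsert m (insert m x (RS w)) = uninsert m (insert m x' (RS w')).
  by rewrite eqRS.
rewrite !insertK ?RS_labels_lt ?RS_is_bitableau ?(path_sorted w'_m)
  ?(path_sorted w_m) // => -[-> /IHw->] //.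
exact: path_sorted w_m.
Qed.

Lemma RS_surj l t : sorted >%O l -> is_bitableau t -> perm_eq (labels t) l ->
  exists2 w, map fst w = l & RS w = t.
Proof.
elim: l t => [|m l IHl] t /=.
  move=> _ t_ok /perm_nilP t0; exists [::] => //.
  by case: t t_ok t0 => // -[].
move=> l_m t_ok t_l.
have l_lt : all (fun i => i < m)%O l.
  apply: order_path_min l_m.
  by move=> a b c ba ac; apply: lt_trans ba.
have t_m : all (fun i => i <= m)%O (labels t).
  by rewrite (perm_all _ t_l) /= lexx; apply: sub_all l_lt => i; apply: ltW.
have m_t : m \in labels t by rewrite (perm_mem t_l) mem_head.
have [u_ok def_t] := uninsertK t_ok t_m m_t.
have [|w def_l def_u] := IHl (uninsert m t).2 (path_sorted l_m) u_ok.
  rewrite -(perm_cons m); apply: perm_trans t_l.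
  by rewrite -[in X in perm_eq _ X]def_t perm_sym insert_labels.
exists ((m, (uninsert m t).1) :: w); rewrite /= ?def_l //.
by rewrite def_u.
Qed.

End Bitableaux.

(** * Bitableaux as pairs of tableaux *)

Lemma is_tableau_cons (A : Type) (R C : rel A) r t :
  is_tableau R C (r :: t) =
  [&& 0 < size r, sorted R r, size (head [::] t) <= size r,
      all (fun p => C p.1 p.2) (zip r (head [::] t)) & is_tableau R C t].
Proof.
rewrite /is_tableau /is_partition /= inE negb_or eq_sym -lt0n.
case: t => [|r' t] /=; first by case: r => //= z r; rewrite ?andbT.
by rewrite -!andbA; do !bool_congr.
Qed.

Section Projections.

Variables (dL dA : Order.disp_t) (L : orderType dL) (A : orderType dA).
Implicit Types t : seq (seq (L * A)).

Lemma is_bitableauE t :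
  is_bitableau t = is_tableau <%O <%O (map unzip1 t) &&
                   is_tableau <=%O <%O (map unzip2 t).
Proof.
elim: t => //= r t ->; rewrite !is_tableau_cons !size_map.
have head_map (B : Type) (h : L * A -> B) :
  head [::] (map (map h) t) = map h (head [::] t) by case: t.
rewrite !head_map !size_map /above !sorted_map (sorted_relI (relpre fst <%O)).
have -> : all (fun pq => col_rel pq.1 pq.2) (zip r (head [::] t)) =
    all (fun p => p.1 < p.2)%O (zip (unzip1 r) (unzip1 (head [::] t))) &&
    all (fun p => p.1 < p.2)%O (zip (unzip2 r) (unzip2 (head [::] t))).
  elim: r (head [::] t) => [|p r IHr] [|p' r'] //=.
  by rewrite IHr /col_rel andbACA.
case: (0 < _); case: (_ <= _) => //=; rewrite ?andbF //=.
by rewrite -!andbA; do !bool_congr.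
Qed.

Lemma unzip_inj t t' : map unzip1 t = map unzip1 t' ->
  map unzip2 t = map unzip2 t' -> t = t'.
Proof.
elim: t t' => [|r t IHt] [|r' t'] //= [er1 et1] [er2 et2].
by rewrite (IHt t') // -[r]zip_unzip er1 er2 zip_unzip.
Qed.

Lemma unzip_surj (S : seq (seq L)) (T : seq (seq A)) : shape S = shape T ->
  exists2 t, map unzip1 t = S & map unzip2 t = T.
Proof.
elim: S T => [|r S IHS] [|r' T] //=; first by exists [::].
case=> er eST.
have [t <- <-] := IHS _ eST.
by exists (zip r r' :: t); rewrite /= ?unzip1_zip ?unzip2_zip // er.
Qed.

End Projections.


(** * Generalized permutations as words *)

Section GeneralizedPermutations.

Variables (dL dA : Order.disp_t) (L : orderType dL) (A : orderType dA).
Implicit Types (a : seq A) (b l : seq L) (w : seq (L * A)).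

(** Sorting the columns by bottom entry; the top entry is included in the sort
key only to have a total order, the bottom entries being distinct. *)
Definition word_of a b : seq (L * A) :=
  rev (sort <=%O (zip b a : seq (L *l A))).

Definition swap (T U : Type) (p : T * U) := (p.2, p.1).

Lemma map_swap_zip (T U : Type) (s : seq T) (s' : seq U) :
  map (@swap T U) (zip s s') = zip s' s.
Proof. by elim: s s' => [|x s IHs] [|y s'] //=; rewrite IHs. Qed.

Lemma perm_word_of a b : perm_eq (word_of a b) (zip b a).
Proof. by rewrite perm_rev perm_sort. Qed.

Lemma word_of_labels a b l : size a = size b -> sorted <%O l -> perm_eq b l ->
  map fst (word_of a b) = rev l.
Proof.
move=> eq_sz l_srt b_l; rewrite map_rev; congr rev.
apply: (sorted_eq le_trans le_anti).
- rewrite sorted_map; apply: sub_sorted (sort_le_sorted _) => p q /=.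
  by rewrite leEprodlexi => /andP[].
- by apply: sub_sorted l_srt => x y; apply: ltW.
apply: perm_trans b_l; rewrite -{2}(@unzip1_zip _ _ b a) ?eq_sz //.
by apply: perm_map; rewrite perm_sort.
Qed.

Lemma word_of_inj a b a' b' : size a = size b -> size a' = size b' ->
    sorted <=%O (zip a b : seq (A *l L)) ->
    sorted <=%O (zip a' b' : seq (A *l L)) ->
  word_of a b = word_of a' b' -> (a, b) = (a', b').
Proof.
move=> sz sz' srt srt' eq_w.
have /(perm_map (@swap _ _)) : perm_eq (zip b a) (zip b' a').
  by rewrite -(permPl (perm_word_of a b)) eq_w perm_word_of.
rewrite !map_swap_zip => /(sorted_eq le_trans le_anti srt srt') eq_zip.
rewrite -(@unzip1_zip _ _ a b) ?sz // -(@unzip1_zip _ _ a' b') ?sz' //.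
rewrite -{2}(@unzip2_zip _ _ a b) ?sz // -{2}(@unzip2_zip _ _ a' b') ?sz' //.
by rewrite [zip a b]eq_zip.
Qed.

Lemma word_of_surj w : sorted >%O (map fst w) ->
  exists a b, [/\ size a = size b, sorted <=%O (zip a b : seq (A *l L)) &
                  word_of a b = w].
Proof.
move=> w_srt; set s := sort <=%O (map (@swap _ _) w : seq (A *l L)).
exists (unzip1 s), (unzip2 s); rewrite !size_map zip_unzip; split=> //.
  exact: sort_le_sorted.
rewrite -[RHS]revK; congr rev.
have rw_srt : sorted <=%O (rev w : seq (L *l A)).
  rewrite rev_sorted; move: w_srt; rewrite sorted_map.
  apply: sub_sorted => p q /= lt_qp.
  by rewrite leEprodlexi (ltW lt_qp) leNgt lt_qp.
apply: (sorted_eq le_trans le_anti (sort_le_sorted _) rw_srt).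
rewrite perm_sort perm_sym perm_rev perm_sym -map_swap_zip zip_unzip.
rewrite -[in X in perm_eq _ X](map_id w).
have -> : map id w = map (@swap _ _) (map (@swap _ _) w).
  by rewrite -map_comp; apply: eq_map => -[].
by apply: perm_map; rewrite perm_sort.
Qed.

End GeneralizedPermutations.

(** * The graded lexicographic order *)

Section GradedLexicographicOrder.

Variable k : nat.

Lemma mset_word_inj : injective (@mset_word k).
Proof.
move=> M M' /perm_sort_leP eq_M; apply/msetP => x.
by rewrite -!count_mem_mset; apply/permP.
Qed.

Lemma mset_lt_irr : irreflexive (@mset_lt k).
Proof. by move=> M; rewrite /mset_lt ltnn eqxx ltxx. Qed.

Lemma mset_lt_trans : transitive (@mset_lt k).
Proof.
move=> M' M M''; rewrite /mset_lt.
case/orP=> [lt1 | /andP[/eqP-> lt1]]; case/orP=> [lt2 | /andP[/eqP<- lt2]].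
- by rewrite (ltn_trans lt1).
- by rewrite lt1.
- by rewrite lt2.
- by rewrite eqxx (lt_trans lt1) ?orbT.
Qed.

Lemma mset_le_total : total (@mset_le k).
Proof.
move=> M M'; rewrite /mset_le /mset_lt.
case: ltngtP => //=; rewrite ?orbT // => _.
rewrite [M' == M]eq_sym orbACA orbb -(inj_eq mset_word_inj).
by case: (ltgtP (mset_word M : seqlexi 'I_k) (mset_word M')) => [_|_|eqM];
  rewrite ?orbT // eqM eqxx.
Qed.

End GradedLexicographicOrder.

(** A separate name for the type, so that its order is the graded lexicographic
one and its elements remain multisets by conversion. *)
Definition graded_mset (k : nat) : Type := {mset 'I_k}%mset.
HB.instance Definition _ k := Choice.on (graded_mset k).
HB.instance Definition _ k :=
  @Order.LtLe_isPOrder.Build (Order.Disp tt tt) (graded_mset k)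
    (@mset_le k) (@mset_lt k) (fun _ _ => erefl)
    (@mset_lt_irr k) (@mset_lt_trans k).
HB.instance Definition _ k :=
  @Order.POrder_isTotal.Build (Order.Disp tt tt) (graded_mset k)
    (@mset_le_total k).

HB.instance Definition _ (K : choiceType) :=
  Monoid.isComLaw.Build {mset K}%mset mset0%mset (@msetD K)
    (@msetDA K) (@msetDC K) (@mset0D K).

(** * The bijection *)

Lemma perm_mset_union (k : nat) (s s' : seq (graded_mset k)) :
  perm_eq s s' -> mset_union s = mset_union s'.
Proof. exact: perm_big. Qed.

(** By antisymmetry, the two conditions on consecutive columns together say that
the columns increase lexicographically, the top entry coming first. *)
Lemma is_generalized_permutationE (n k : nat)
    (a : n.-tuple {mset 'I_k}%mset) (b : n.-tuple 'I_n) :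
  is_generalized_permutation (@mset_le k) <=%O a b =
  sorted <=%O (zip a b : seq (graded_mset k *l 'I_n)).
Proof.
apply: eq_sorted => p q; rewrite leEprodlexi.
have -> : (p.1 == q.1) =
    (p.1 <= q.1 :> graded_mset k)%O && (q.1 <= p.1 :> graded_mset k)%O.
  exact: (eq_le (p.1 : graded_mset k)).
have -> : mset_le p.1 q.1 = (p.1 <= q.1 :> graded_mset k)%O by [].
by case: (_ <= _)%O.
Qed.

Lemma enum_ord_sorted n : sorted <%O (enum 'I_n).
Proof.
have : sorted ltn (map val (enum 'I_n)) by rewrite val_enum_ord iota_ltn_sorted.
by rewrite sorted_map; apply: sub_sorted => i j.
Qed.

Lemma uniq_perm_enum_ord n (b : n.-tuple 'I_n) : uniq b -> perm_eq b (enum 'I_n).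
Proof.
move=> b_uniq; apply: uniq_perm; rewrite ?enum_uniq //.
apply: (uniq_min_size b_uniq _ _).2 => [i _|]; first by rewrite mem_enum.
by rewrite size_enum_ord size_tuple.
Qed.

(** Choice on the source provides the inverse. *)
Lemma inj_surj_bijective (T : choiceType) (U : eqType) (f : T -> U) :
  injective f -> (forall u, exists x, f x == u) -> bijective f.
Proof.
move=> f_inj f_surj; exists (fun u => xchoose (f_surj u)) => [x|u].
  by apply/f_inj/eqP/(xchooseP (f_surj (f x))).
exact/eqP/(xchooseP (f_surj u)).
Qed.

Lemma word_of_labels_ord (dA : Order.disp_t) (A : orderType dA) (n : nat)
    (a : n.-tuple A) (b : n.-tuple 'I_n) : uniq b ->
  map fst (word_of a b) = rev (enum 'I_n).
Proof.
move=> b_uniq; apply: word_of_labels; first by rewrite !size_tuple.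
  exact: enum_ord_sorted.
exact: uniq_perm_enum_ord.
Qed.

Definition RS_tableau (n k : nat) (a : seq (graded_mset k)) (b : seq 'I_n) :=
  RS (mset0 : graded_mset k) (word_of a b).

Lemma RS_tableau_pair (n k : nat) (w : multiset_gen_perm n k)
    (t := RS_tableau (sval w).1 (sval w).2) :
  [&& shape (map unzip1 t) == shape (map unzip2 t),
      is_standard_Young_tableau (map unzip1 t) &
      is_semistandard_multiset_tableau (map unzip2 t)].
Proof.
rewrite /t => {t}; case: w => -[a b] /= /andP[_ b_uniq].
have w_l := word_of_labels_ord (a : n.-tuple (graded_mset k)) b_uniq.
set t := RS_tableau a b.
have : is_bitableau t.
  by apply: RS_is_bitableau; rewrite w_l rev_sorted enum_ord_sorted.
rewrite is_bitableauE => /andP[S_tab T_tab].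
rewrite /is_standard_Young_tableau S_tab -map_flatten.
rewrite [is_semistandard_multiset_tableau _]T_tab andbT.
apply/andP; split.
  by rewrite /shape -!map_comp; apply/eqP/eq_map => r /=; rewrite !size_map.
apply: perm_trans (RS_labels _ _) _.
by rewrite w_l perm_rev.
Qed.

Theorem proposition5p1 (n k : nat) (hn : 0 < n) (hk : 0 < k) :
  exists f : multiset_gen_perm n k -> tableau_pair n k,
    bijective f /\
    forall w : multiset_gen_perm n k,
      content (sval (f w)).2 = mset_union (sval w).1.
Proof.
pose f (w : multiset_gen_perm n k) : tableau_pair n k :=
  exist _ (_, _) (RS_tableau_pair w).
exists f; split; last first.
  case=> -[a b] w_ok; rewrite /content /= -map_flatten.
  apply: perm_mset_union; apply: perm_trans (RS_entries _ _) _.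
  rewrite -{2}[tval a](@unzip2_zip _ _ b a) ?size_tuple //.
  exact/perm_map/perm_word_of.
apply: inj_surj_bijective.
  case=> -[a b] w_ok [[a' b'] w'_ok] /(congr1 val) /= [eq1 eq2].
  have /andP[/= ab b_uniq] := w_ok; have /andP[/= ab' b'_uniq] := w'_ok.
  have /RS_inj := unzip_inj eq1 eq2.
  rewrite !word_of_labels_ord // rev_sorted => /(_ (enum_ord_sorted n) erefl).
  rewrite !is_generalized_permutationE in ab ab' => /word_of_inj.
  rewrite !size_tuple => /(_ erefl erefl ab ab') [ea eb].
  apply: val_inj => /=; congr pair; exact: val_inj.
case=> -[S T] /= ST_ok.
have /and3P[/eqP eq_sh /andP[S_tab S_enum] T_tab] := ST_ok.
have [t def_S def_T] := @unzip_surj _ _ 'I_n (graded_mset k) S T eq_sh.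
have t_ok : is_bitableau (t : seq (seq ('I_n * graded_mset k))).
  by rewrite is_bitableauE def_S def_T S_tab.
have [||w w_l def_t] :=
  @RS_surj _ _ _ (graded_mset k) mset0 (rev (enum 'I_n)) t _ t_ok.
- by rewrite rev_sorted enum_ord_sorted.
- by rewrite /labels map_flatten def_S perm_sym perm_rev perm_sym.
have [|a [b [sz_ab ab def_w]]] := @word_of_surj _ _ _ _ w.
  by rewrite w_l rev_sorted enum_ord_sorted.
have b_enum : perm_eq b (enum 'I_n).
  have := perm_map fst (perm_word_of a b).
  by rewrite def_w w_l -/(unzip1 _) unzip1_zip ?sz_ab // perm_rev perm_sym.
have sz_b : size b == n by rewrite (perm_size b_enum) size_enum_ord.
have sz_a : size a == n by rewrite sz_ab.
have w_ok : is_generalized_permutation (@mset_le k) <=%O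
    (Tuple sz_a : n.-tuple {mset 'I_k}%mset) (Tuple sz_b) && uniq b.
  by rewrite is_generalized_permutationE ab (perm_uniq b_enum) enum_uniq.
exists (exist _ (_, _) w_ok); apply/eqP/val_inj => /=.
by rewrite /RS_tableau def_w def_t def_S def_T.
Qed.
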